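(* Let $q$ be a power of an odd prime, let $G=\mathrm{PSL}(2,q)$ or $G=\mathrm{PGL}(2,q)$, and let $C$ be a conjugacy class of $G$ such that $\operatorname{Conj}(G,C)$ is a simple quandle. Then the profile of $\operatorname{Conj}(G,C)$ is of the form $1^k\lambda^l$, where $\lambda=\operatorname{ord}(x)$ for $x\in C$.
   Context: A quandle is a set $X$ with a binary operation $\triangleright$ such that (1) $x\triangleright x=x$ for all $x$; (2) for every $x\in X$ the right translation $R_x:X\to X$, $R_x(y)=y\triangleright x$, is a bijection; (3) $(x\triangleright y)\triangleright z=(x\triangleright z)\triangleright(y\triangleright z)$ for all $x,y,z$. A quandle $X$ is simple if $|X|>1$ and every quandle homomorphism from $X$ is either injective or constant. For a group $G$ and a subset $C\subseteq G$ closed under conjugation, $\operatorname{Conj}(G,C)$ is the quandle on $C$ with operation $x\triangleright y=yxy^{-1}$, so $R_x(y)=xyx^{-1}$. The profile of a finite quandle is the set of cycle types (partition types) of all right translations $R_x$, $x\in X$; for a connected quandle (one on which $\langle R_x:x\in X\rangle$ acts transitively) all $R_x$ have the same cycle type, and the profile is that common cycle type. The profile is of the form $1^k\lambda^l$ if every $R_x$ has, for some nonnegative integers $k,l$, exactly $k$ fixed points and $l$ cycles of length $\lambda$ and no other cycles. $\mathrm{PSL}(2,q)=\mathrm{SL}(2,q)/\{\pm I\}$ and $\mathrm{PGL}(2,q)=\mathrm{GL}(2,q)/\{\lambda I:\lambda\in\mathbb{F}_q^*\}$. *)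

(* Defs.v *)
From HB Require Import structures.
From mathcomp Require Import all_boot all_order all_algebra all_fingroup.

Set Implicit Arguments.
Unset Strict Implicit.
Unset Printing Implicit Defensive.

Import GRing.Theory GroupScope.

HB.mixin Record isQuandle (X : Type) := {
  qop : X -> X -> X;
  qopxx : forall x, qop x x = x;
  qop_bij : forall x, bijective (fun y => qop y x);
  qopD : forall x y z, qop (qop x y) z = qop (qop x z) (qop y z)
}.

#[short(type="quandleType")]
HB.structure Definition Quandle := {X of isQuandle X}.

#[short(type="finQuandleType")]
HB.structure Definition FinQuandle := {X of isQuandle X & Finite X}.

Definition quandle_hom (X Y : quandleType) (f : X -> Y) : Prop :=
  forall x y, f (qop x y) = qop (f x) (f y).

Definition simple_quandle (X : quandleType) : Prop :=
  (exists x y : X, x <> y) /\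
  forall (Y : quandleType) (f : X -> Y), quandle_hom f ->
    injective f \/ (forall x y, f x = f y).

Section Profile.
Variable X : finQuandleType.

Definition rtrans (x : X) : {perm X} := perm (bij_inj (qop_bij x)).

(* [porbits s] contains the singleton orbits, so fixed points give parts 1. *)
Definition cycle_type (T : finType) (s : {perm T}) : seq nat :=
  sort geq [seq #|(c : {set T})| | c <- enum (porbits s)].

(* Only membership in this sequence is meaningful: it stands for a set. *)
Definition profile : seq (seq nat) := [seq cycle_type (rtrans x) | x : X].

Definition profile_of_form (lambda : nat) : Prop :=
  exists k l : nat, forall t, t \in profile ->
    perm_eq t (nseq k 1%N ++ nseq l lambda).

End Profile.

Definition conj_closed (gT : finGroupType) (G C : {set gT}) : Prop :=
  C \subset G /\ (forall g x, g \in G -> x \in C -> g * x * g^-1 \in C).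

Record conj_quandle (gT : finGroupType) (G C : {set gT})
  (hC : conj_closed G C) :=
  ConjQuandle { conj_val : gT; conj_valP : conj_val \in C }.

Section ConjQuandle.
Variables (gT : finGroupType) (G C : {set gT}) (hC : conj_closed G C).
Local Notation Q := (conj_quandle hC).

HB.instance Definition _ := [isSub for @conj_val gT G C hC].
HB.instance Definition _ := [Finite of Q by <:].

Lemma conj_op_subproof (x y : Q) : val y * val x * (val y)^-1 \in C.
Proof.
case: hC => sCG clC; apply: clC; last exact: valP.
exact: (subsetP sCG) (valP y).
Qed.

Definition conj_op (x y : Q) : Q :=
  ConjQuandle hC (conj_op_subproof x y).

Fact conj_opxx x : conj_op x x = x.
Proof. by apply: val_inj; rewrite /= mulgK. Qed.

Fact conj_op_bij x : bijective (fun y => conj_op y x).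
Proof.
apply: injF_bij => y z /(congr1 val) /= /mulIg /mulgI; exact: val_inj.
Qed.

Fact conj_opD x y z :
  conj_op (conj_op x y) z = conj_op (conj_op x z) (conj_op y z).
Proof. by apply: val_inj; rewrite /= !invMg !invgK !mulgA !mulgKV. Qed.

HB.instance Definition _ := isQuandle.Build Q conj_opxx conj_op_bij conj_opD.

End ConjQuandle.

Lemma class_conj_closed (gT : finGroupType) (G : {group gT}) (C : {set gT}) :
  C \in classes G -> conj_closed G C.
Proof.
case/imsetP=> x Gx ->; split; first by rewrite class_subG.
move=> g _ Gg /imsetP[h Gh ->]; apply/imsetP; exists (h * g^-1).
  by rewrite groupM ?groupV.
by rewrite !conjgE invMg invgK !mulgA.
Qed.

Section LinearGroups.
Variable F : finFieldType.
Local Notation GL2 := {'GL_2[F]}.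
Local Open Scope ring_scope.

Definition SL2 : {set GL2} := [set g : GL2 | \det (GLval g) == 1].

Definition pmI : {set GL2} :=
  [set g : GL2 | (GLval g == 1%:M) || (GLval g == - 1%:M)].

Definition scalI : {set GL2} := [set g : GL2 | is_scalar_mx (GLval g)].

Fact SL2_group_set : group_set SL2.
Proof.
apply/group_setP; split=> [|x y]; rewrite !inE ?det1 //.
by move=> /eqP dx /eqP dy; rewrite GL_MxE det_mulmx dx dy mulr1.
Qed.
Canonical SL2_group := Group SL2_group_set.

Fact pmI_group_set : group_set pmI.
Proof.
apply/group_setP; split=> [|x y]; rewrite !inE ?eqxx // GL_MxE.
by move=> /orP[]/eqP-> /orP[]/eqP->;
  rewrite ?mulNmx ?mulmxN ?mul1mx ?opprK eqxx ?orbT.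
Qed.
Canonical pmI_group := Group pmI_group_set.

Fact scalI_group_set : group_set scalI.
Proof.
apply/group_setP; split=> [|x y]; rewrite !inE ?scalar_mx_is_scalar //.
move=> /is_scalar_mxP[a xa] /is_scalar_mxP[b yb].
by rewrite GL_MxE xa yb -scalar_mxM scalar_mx_is_scalar.
Qed.
Canonical scalI_group := Group scalI_group_set.

Fact scalI_cent (x y : GL2) : x \in scalI -> (x ^ y = x)%g.
Proof.
rewrite inE => /is_scalar_mxP[a xa].
have cxy : (x * y = y * x)%g.
  by apply: val_inj; rewrite [LHS]GL_MxE [RHS]GL_MxE xa scalar_mxC.
by rewrite conjgE cxy mulKg.
Qed.

Fact scalI_normal : scalI <| 'GL_2[F].
Proof.
apply/andP; split; first by apply/subsetP => x _; rewrite inE.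
apply/subsetP => y _; rewrite inE; apply/subsetP => _ /imsetP[x sx ->].
by rewrite scalI_cent.
Qed.

Fact pmI_sub_scalI : pmI \subset scalI.
Proof.
apply/subsetP => x; rewrite !inE => /orP[]/eqP->;
  by rewrite -?raddfN scalar_mx_is_scalar.
Qed.

Fact pmI_normal : pmI <| SL2.
Proof.
apply/andP; split; apply/subsetP => y.
  rewrite !inE => /orP[]/eqP->; rewrite ?det1 //.
  by rewrite -scaleN1r detZ det1 mulr1 sqrrN expr1n.
move=> _; rewrite inE; apply/subsetP => _ /imsetP[x sx ->].
by rewrite scalI_cent // (subsetP pmI_sub_scalI).
Qed.

(* The two normality facts above make these genuine quotient groups: in general
   [A / H] denotes the quotient of ['N_A(H) * H] by [H]. *)
Definition PSL2 : {group coset_of pmI} := (SL2 / pmI)%G.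

Definition PGL2 : {group coset_of scalI} := ('GL_2[F] / scalI)%G.

End LinearGroups.

(* Main.v *)
Require Import Defs.
From HB Require Import structures.
From mathcomp Require Import all_boot all_order all_algebra all_fingroup.
From mathcomp Require Import cyclic ring.

Set Implicit Arguments.
Unset Strict Implicit.
Unset Printing Implicit Defensive.

Import GroupScope.

(** Right translation by [x] is conjugation by [x], so its [j]-th power fixes [y]
    exactly when [y] commutes with [x ^+ j]. The profile has the form
    [1^k lambda^l] with [lambda = #[x]] as soon as, on the class [C], commuting
    with a nontrivial power of [x] implies commuting with [x]: then every point
    that is not fixed has an orbit of size [#[x]] ([profile_class], which rests
    on [cycle_type_semiregular]).

    In the quotient of a group of invertible 2 x 2 matrices by all the scalar
    matrices it contains, this holds for two conjugate elements [x] and [y]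
    ([commuteX_class]). If lifts of [y]
    and [x ^+ j] commute, then so do lifts of [y] and [x], since the centralizer
    of a nonscalar 2 x 2 matrix is commutative ([comm_mx2_trans]). If they
    commute only up to a scalar other than [1], then the lift of [y] has trace
    zero; so has that of [x], which is conjugate to [y], and [x] has order 2, so
    that [x ^+ j = x]. Both [PSL2] and [PGL2] are quotients of this kind: a
    scalar matrix of determinant one is [1] or [-1]. *)

(** * Permutations with all nontrivial orbits of one size *)

Section CycleType.
Variables (T : finType) (s : {perm T}).

Lemma porbit1P t : reflect (porbit s t = [set t]) (s t == t).
Proof.
have -> : (s t == t) = (t \in 'Fix_('P)(<[s]>)).
  by rewrite afix_cycle ?inE // sub1set inE.
by rewrite porbitE; apply: orbit1P.
Qed.

Lemma card_porbits1 :
  #|[set c in porbits s | #|c| == 1%N]| = #|[set t | s t == t]|.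
Proof.
rewrite -[RHS](card_imset _ (@set1_inj T)).
apply: eq_card => c; rewrite inE.
apply/andP/imsetP=> [[/imsetP[t _ ->]] | [t]].
  rewrite porbitE => /eqP/card_orbit1; rewrite -porbitE => porb_t.
  by exists t; rewrite // inE; apply/porbit1P.
by rewrite inE => /porbit1P porb_t ->; rewrite cards1 -porb_t imset_f.
Qed.

Lemma sum_card_porbits : (\sum_(c in porbits s) #|c| = #|T|)%N.
Proof.
rewrite -cardsT (card_partition (P := porbits s)) //.
have -> : porbits s = orbit 'P <[s]> @: setT.
  apply/setP=> c; apply/imsetP/imsetP=> -[t _ ->]; exists t => //;
    by rewrite porbitE.
by apply: orbit_partition; apply/actsP=> a _ t; rewrite !inE.
Qed.

Lemma card_porbit_free n t :
  (0 < n)%N -> s ^+ n = 1 ->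
  (forall i, (0 < i < n)%N -> (s ^+ i) t != t) -> #|porbit s t| = n.
Proof.
move=> n_gt0 sn1 free.
have -> : porbit s t = [set (s ^+ (i : 'I_n)) t | i in 'I_n].
  apply/setP=> u; apply/porbitP/imsetP=> [[i ->]|[i _ ->]]; last by exists i.
  exists (Ordinal (ltn_pmod i n_gt0)) => //=.
  by rewrite {1}(divn_eq i n) expgD mulnC expgM sn1 expg1n mul1g.
rewrite card_imset ?card_ord // => i j.
(* Two coinciding iterates differ by an exponent below [n] that fixes [t]. *)
wlog le_ij : i j / (i <= j)%N.
  move=> wl; case/orP: (leq_total i j); first exact: wl.
  by move=> le_ji /esym/(wl _ _ le_ji).
rewrite -{1}(subnK le_ij) expgD permM => /esym/perm_inj fix_t.
apply/val_inj/eqP; rewrite eqn_leq le_ij /= -subn_eq0 -leqn0 leqNgt.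
apply/negP=> d_gt0; have /free/eqP[] : (0 < j - i < n)%N => //.
by rewrite d_gt0 (leq_ltn_trans (leq_subr _ _)).
Qed.

(** The orbits have only the sizes [1] and [n]. The orbits of size [1] are the
    fixed points, and the number of the others follows since all sizes add up
    to [#|T|]; so the cycle type depends on [n] and on the number of fixed
    points alone, which is what makes it the same for all right
    translations. *)
Lemma cycle_type_semiregular n (k := #|[set t | s t == t]|) :
    (0 < n)%N -> s ^+ n = 1 ->
    (forall t i, s t != t -> (0 < i < n)%N -> (s ^+ i) t != t) ->
  perm_eq (cycle_type s) (nseq k 1%N ++ nseq ((#|T| - k) %/ n) n).
Proof.
move=> n_gt0 sn1 free.
rewrite /cycle_type perm_sort; set szs := map _ _.
rewrite -(perm_filterC (pred1 1%N) szs).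
have [szs1 szsn] : size (filter (pred1 1%N) szs) = k /\
                   all (pred1 n) (filter (predC (pred1 1%N)) szs).
  split.
    rewrite size_filter count_map -size_filter /k -card_porbits1 cardE.
    rewrite /enum_mem -filter_predI; congr (size _).
    by apply: eq_filter => c /=; rewrite inE andbC.
  apply/allP=> m; rewrite mem_filter /= => /andP[m_neq1 /mapP[c]].
  rewrite mem_enum => /imsetP[t _ ->] def_m; move: m_neq1; rewrite {m}def_m.
  move=> porb_t; apply/eqP/(card_porbit_free n_gt0 sn1) => i; apply: free.
  by apply: contraNneq porb_t => /eqP/porbit1P->; rewrite cards1.
have eq1 : filter (pred1 1%N) szs = nseq k 1%N.
  by rewrite -szs1; apply/all_pred1P/filter_all.
have eqn := all_pred1P _ _ szsn; rewrite eq1 eqn.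
set l := size _ in eqn *; suffices -> : ((#|T| - k) %/ n = l)%N by [].
have : sumn szs = #|T|.
  by rewrite sumnE big_map big_enum /= ?sum_card_porbits.
rewrite -(perm_sumn (permEl (perm_filterC (pred1 1%N) szs))).
rewrite eq1 eqn sumn_cat !sumn_nseq mul1n => <-.
by rewrite addKn mulKn.
Qed.

End CycleType.

(** * Two-by-two matrices *)

Section Mat2.
Local Open Scope ring_scope.
Import GRing.Theory.

Lemma mx2P (R : Type) (A B : 'M[R]_2) :
  A 0 0 = B 0 0 -> A 0 1 = B 0 1 -> A 1 0 = B 1 0 -> A 1 1 = B 1 1 -> A = B.
Proof.
move=> e00 e01 e10 e11; apply/matrixP=> i j.
have I2 (k : 'I_2) : k = 0 \/ k = 1.
  by case: k => [[|[|//]] k_lt2]; [left | right]; apply: val_inj.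
by case: (I2 i) => ->; case: (I2 j) => ->.
Qed.

Lemma mulmx2E (R : pzSemiRingType) (A B : 'M[R]_2) i j :
  (A *m B) i j = A i 0 * B 0 j + A i 1 * B 1 j.
Proof.
rewrite mxE !big_ord_recl big_ord0 addr0.
by congr (_ * _ + A i _ * B _ j); apply: val_inj.
Qed.

(** By Cayley-Hamilton, the square is then [- \det A]. *)
Lemma trace0_sqr_scalar (R : comNzRingType) (A : 'M[R]_2) :
  \tr A = 0 -> is_scalar_mx (A *m A).
Proof.
rewrite /mxtrace !big_ord_recl big_ord0 addr0.
have -> : lift ord0 ord0 = 1 :> 'I_2 by apply: val_inj.
move/eqP; rewrite addr_eq0 => /eqP A00.
apply/is_scalar_mxP; exists (A 0 0 * A 0 0 + A 0 1 * A 1 0).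
by apply: mx2P; rewrite mulmx2E !mxE ?mulr1n ?mulr0n A00; ring.
Qed.

(** A matrix modulo scalars is the triple of its two off-diagonal entries and
    the difference [r] of its diagonal entries. The commutator of [X] and [M]
    has as entries, up to sign, the 2 x 2 minors of the two triples. If it
    vanishes, the triple of [X] is a multiple, by [b], of that of [M], which is
    nonzero because [M] is not scalar. *)
Lemma comm_mx2_span (K : fieldType) (M X : 'M[K]_2) :
  ~~ is_scalar_mx M -> X *m M = M *m X -> exists a b, X = a%:M + b *: M.
Proof.
move=> nsM /matrixP eqXM.
pose r (Y : 'M[K]_2) := Y 0 0 - Y 1 1 : K.
have := (eqXM 0 0, eqXM 0 1, eqXM 1 0); rewrite !mulmx2E => -[[h00 h01] h10].
have e1 : X 0 1 * M 1 0 = M 0 1 * X 1 0.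
  by apply: (addrI (X 0 0 * M 0 0)); rewrite h00; ring.
have e2 : X 0 1 * r M = M 0 1 * r X.
  apply/eqP; rewrite -subr_eq0 -oppr_eq0; apply/eqP.
  by move/eqP: h01; rewrite -subr_eq0 => /eqP <-; rewrite /r; ring.
have e3 : X 1 0 * r M = M 1 0 * r X.
  apply/eqP; rewrite -subr_eq0; apply/eqP.
  by move/eqP: h10; rewrite -subr_eq0 => /eqP <-; rewrite /r; ring.
(* [b] is the quotient at any entry where the triple of [M] is nonzero. *)
have [b [b01 b10 br]] :
    exists b, [/\ X 0 1 = b * M 0 1, X 1 0 = b * M 1 0 & r X = b * r M].
  have quot (m x n y : K) : m != 0 -> m * y = x * n -> y = x / m * n.
    by move=> nz_m eq_my; apply: (mulfI nz_m); rewrite eq_my; field.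
  have [M01|nz] := eqVneq (M 0 1) 0; last first.
    by exists (X 0 1 / M 0 1); split; [field | apply: quot | apply: quot].
  have [M10|nz] := eqVneq (M 1 0) 0; last first.
    exists (X 1 0 / M 1 0); split; [|by field | by apply: quot].
    by apply: quot; rewrite // mulrC e1 mulrC.
  have nz : r M != 0.
    apply: contraNneq nsM => /eqP; rewrite subr_eq0 => /eqP M00.
    apply/is_scalar_mxP; exists (M 1 1).
    by apply: mx2P; rewrite !mxE ?mulr1n ?mulr0n.
  exists (r X / r M); split; [| |by field].
    by apply: quot; rewrite // mulrC e2 mulrC.
  by apply: quot; rewrite // mulrC e3 mulrC.
exists (X 1 1 - b * M 1 1), b.
have X00 : X 0 0 = X 1 1 + b * r M by rewrite -br /r; ring.
by apply: mx2P; rewrite !mxE ?mulr1n ?mulr0n ?X00 ?b01 ?b10 /r; ring.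
Qed.

Lemma comm_mx2_trans (K : fieldType) (M X Y : 'M[K]_2) :
  ~~ is_scalar_mx M -> X *m M = M *m X -> Y *m M = M *m Y ->
  X *m Y = Y *m X.
Proof.
move=> nsM /(comm_mx2_span nsM)[a [b ->]] commYM.
by rewrite mulmxDl mulmxDr scalar_mxC -scalemxAl -scalemxAr commYM.
Qed.

End Mat2.

(** * Commutation with powers in quotients by scalars *)

Section ScalarQuotient.
Import GRing.Theory.
Variables (F : finFieldType) (H Z : {group {'GL_2[F]}}).
Hypotheses (sZscal : Z \subset scalI F) (sHscalZ : H :&: scalI F \subset Z).

Lemma scal_norm (g : {'GL_2[F]}) : g \in 'N(Z).
Proof.
rewrite inE; apply/subsetP=> _ /imsetP[z Zz ->].
by rewrite scalI_cent ?(subsetP sZscal).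
Qed.

Lemma mxtraceJ (A g : {'GL_2[F]}) : (\tr (GLval (A ^ g)) = \tr (GLval A))%R.
Proof.
by rewrite conjgE GL_MxE mxtrace_mulC -GL_MxE mulgK.
Qed.

(** Lift [x] to [A] and [y] to a conjugate [B] of [A]; then [B] commutes with
    [A ^+ j] up to a scalar [a]. If [a = 1], then [A] and [B] both commute with
    the nonscalar matrix [A ^+ j], hence with each other. Otherwise [B] is
    [a] times a conjugate of itself, so its trace is zero. The
    trace of [A] is the same, so [A ^+ 2] is scalar and [x] is an involution:
    in this case [x ^+ j != 1] can only be [x]. *)
Lemma commuteX_class x y j :
    x \in H / Z -> y \in x ^: (H / Z) -> x ^+ j != 1 ->
  commute y (x ^+ j) -> commute y x.
Proof.
case/morphimP=> A nA HA -> {x} /imsetP[_ /morphimP[g ng Hg ->] ->].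
rewrite -morphJ //; have [B defB] : exists B, B = A ^ g by exists (A ^ g).
rewrite -defB.
have [nB nAj] : B \in 'N(Z) /\ A ^+ j \in 'N(Z) by split; apply: scal_norm.
rewrite -morphX // => ntAj; rewrite /commute -!morphM // => comBAj.
have Aj_nscal : A ^+ j \notin scalI F.
  apply: contra ntAj => scAj; apply/eqP/coset_id.
  by apply: (subsetP sHscalZ); rewrite inE groupX.
have [z Zz eqBA] := kercoset_rcoset (groupM nB nAj) (groupM nAj nB) comBAj.
have := subsetP sZscal z Zz; rewrite inE => /is_scalar_mxP[a def_z].
have [a1|a_neq1] := eqVneq a 1%R.
  suffices -> : B * A = A * B by [].
  apply: val_inj; rewrite [LHS]GL_MxE [RHS]GL_MxE.
  apply: (@comm_mx2_trans _ (GLval (A ^+ j))).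
  - by move: Aj_nscal; rewrite inE.
  - have := congr1 (@GLval _ _) eqBA.
    by rewrite !GL_MxE def_z a1 mul1mx.
  - have := congr1 (@GLval _ _) (commuteX j (commute_refl A)).
    by rewrite !GL_MxE.
have trB : (\tr (GLval B) = 0)%R.
  have eqB : B = z * B ^ (A ^- j).
    by rewrite (conjgE B) invgK !mulgA -(mulgA z) -eqBA mulgK.
  have /eqP := congr1 (fun u => \tr (GLval u))%R eqB.
  rewrite GL_MxE def_z mul_scalar_mx mxtraceZ mxtraceJ.
  rewrite -[X in X == _]mul1r -subr_eq0 -mulrBl mulf_eq0 subr_eq0.
  by rewrite eq_sym (negPf a_neq1) => /eqP.
have trA : (\tr (GLval A) = 0)%R by rewrite -trB defB mxtraceJ.
have A2 : coset_morphism Z A ^+ 2 = 1.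
  rewrite -morphX //; apply: coset_id; apply: (subsetP sHscalZ).
  by rewrite inE groupX // inE expgS expg1 GL_MxE trace0_sqr_scalar.
have Aj : coset_morphism Z A ^+ j = if odd j then coset_morphism Z A else 1.
  rewrite -{1}(odd_double_half j) expgD -mul2n expgM A2 expg1n mulg1.
  by case: odd.
move: ntAj comBAj; rewrite !morphM // morphX // Aj.
by case: odd => //; rewrite eqxx.
Qed.

End ScalarQuotient.

(** * Profiles of conjugation quandles *)

Section ConjQuandle.
Variables (gT : finGroupType) (G C : {set gT}) (hC : conj_closed G C).
Local Notation Q := (conj_quandle hC).

(** Here [t ^ g] is [g^-1 * t * g], whence the inverse. *)
Lemma val_rtransX (x t : Q) i :
  val ((rtrans x ^+ i) t) = val t ^ (val x ^- i).
Proof.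
rewrite conjgE invgK; elim: i => [|i IHi].
  by rewrite perm1 invg1 mulg1 mul1g.
by rewrite expgSr permM permE /= IHi expgS invMg !mulgA.
Qed.

Lemma rtransX_fix (x t : Q) i :
  ((rtrans x ^+ i) t == t) = (val t \in 'C[val x ^+ i]).
Proof.
rewrite -val_eqE val_rtransX conjg_fix.
by rewrite (sameP commgP cent1P) cent1C groupV -[LHS]cent1C.
Qed.

Lemma card_rtrans_fix (x : Q) : #|[set t | rtrans x t == t]| = #|'C_C[val x]|.
Proof.
rewrite -(card_imset _ (@val_inj _ _ Q)); apply: eq_card => y.
apply/imsetP/setIP=> [[t] | [Cy cxy]].
  rewrite inE -[rtrans x]expg1 rtransX_fix expg1 => cxt ->; split=> //.
  exact: valP.
exists (ConjQuandle hC Cy) => //.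
by rewrite inE -[rtrans x]expg1 rtransX_fix expg1.
Qed.

End ConjQuandle.

(** The hypothesis says that no power of [x] other than the identity commutes
    with more elements of [C] than [x] itself does. Thus a power of the right
    translation by [x] moves every point that the translation moves, unless it
    is the identity, and the cycle type is known from the number
    [#|'C_C[x]|] of fixed points; conjugation in [G] preserves that number. *)
Lemma profile_class (gT : finGroupType) (G : {group gT}) (C : {set gT})
    (hC : C \in classes G) :
    (forall x y j, x \in C -> y \in C -> x ^+ j != 1 ->
       commute y (x ^+ j) -> commute y x) ->
  forall x, x \in C ->
    profile_of_form (conj_quandle (class_conj_closed hC)) #[x].
Proof.
move=> cent_pow x Cx.
have [x_conj CJ] : (forall u, u \in C -> exists2 g, g \in G & u = x ^ g) /\
                   (forall g, g \in G -> C :^ g = C).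
  case/imsetP: (hC) Cx => x0 _ -> /class_eqP <-.
  split=> [u /imsetP | g Gg]; first by [].
  exact/normP/(subsetP (class_norm x G)).
exists #|'C_C[x]|, ((#|{: conj_quandle (class_conj_closed hC)}| - #|'C_C[x]|)
                      %/ #[x])%N => _ /imageP[y _ ->].
have [g Gg def_y] := x_conj _ (valP y).
have card_cent : #|'C_C[x]| = #|'C_C[val y]|.
  by rewrite def_y -(cardJg _ g) conjIg (CJ g Gg) cent1J.
have ord_y : #[x] = #[val y] by rewrite def_y orderJ.
rewrite card_cent ord_y -card_rtrans_fix.
apply: cycle_type_semiregular => [||t i]; first exact: order_gt0.
  apply/permP=> t; apply: val_inj.
  by rewrite val_rtransX expg_order invg1 conjg1 perm1.
rewrite -{1}[rtrans y]expg1 !rtransX_fix expg1 => ncyt /andP[i_gt0 lt_i].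
apply: contra ncyt => /cent1P ct; apply/cent1P.
apply: (cent_pow _ _ i); [exact: valP | exact: valP | | ]; last exact: ct.
by rewrite -order_dvdn gtnNdvd.
Qed.

Theorem theorem4p10 (F : finFieldType) (p n : nat)
    (p_prime : prime p) (p_odd : odd p) (n_gt0 : (0 < n)%N)
    (cardF : #|F| = (p ^ n)%N) :
  (forall (C : {set coset_of (pmI F)}) (hC : C \in classes (PSL2 F)),
     simple_quandle (conj_quandle (class_conj_closed hC)) ->
     forall x, x \in C ->
       profile_of_form (conj_quandle (class_conj_closed hC)) #[x])
  /\
  (forall (C : {set coset_of (scalI F)}) (hC : C \in classes (PGL2 F)),
     simple_quandle (conj_quandle (class_conj_closed hC)) ->
     forall x, x \in C ->
       profile_of_form (conj_quandle (class_conj_closed hC)) #[x]).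
Proof.
have rigid (H Z : {group {'GL_2[F]}}) (C : {set coset_of Z}) :
    Z \subset scalI F -> H :&: scalI F \subset Z -> C \in classes (H / Z) ->
  forall x y j, x \in C -> y \in C -> x ^+ j != 1 ->
    commute y (x ^+ j) -> commute y x.
  move=> sZ sHZ /imsetP[x0 Hx0 ->] x y j x0x x0y.
  apply: (commuteX_class sZ sHZ); last by rewrite (class_eqP x0x).
  by apply: subsetP x0x; rewrite class_subG.
split=> C hC _; apply: profile_class.
  apply: (@rigid (SL2_group F) (pmI_group F)) => //; first exact: pmI_sub_scalI.
  apply/subsetP=> g; rewrite !inE => /andP[/eqP det_g /is_scalar_mxP[a def_g]].
  move: det_g; rewrite def_g det_scalar => /eqP; rewrite GRing.sqrf_eq1.
  by case/orP=> /eqP->; [rewrite eqxx | rewrite GRing.raddfN eqxx orbT].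
apply: (@rigid 'GL_2[F] (scalI_group F)) => //.
exact: subsetIr.
Qed.
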